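(* For every $D\ge3$ there is no graph of degree $7$, diameter $D$ and cyclic defect. Furthermore, for every odd $g\ge7$ there is no graph of degree $7$, girth $g$ and cyclic excess.
   Context: For an integer $d\ge 1$ define polynomials $G_{d,m}(x)$ by $G_{d,0}(x)=1$, $G_{d,1}(x)=x+1$, and $G_{d,m+1}(x)=xG_{d,m}(x)-(d-1)G_{d,m-1}(x)$ for $m\ge1$. Let $J_n$ be the $n\times n$ all-ones matrix. For a graph on $n\ge3$ vertices, a cycle matrix is the adjacency matrix $B$ of an $n$-cycle on the same vertex set (i.e., for some ordering $v_1,\dots,v_n$ of the vertices, $B_{ij}=1$ iff $v_i,v_j$ are cyclically consecutive, and $0$ otherwise); this cycle need not consist of edges of the graph. A graph $\Gamma$ of order $n$ with adjacency matrix $A$ is a graph of degree $d$, diameter $D$ and cyclic defect if $\Gamma$ is $d$-regular with $d\ge3$, has diameter $D\ge2$, and $G_{d,D}(A)=J_n+B$ for some cycle matrix $B$. It is a graph of degree $d$, girth $g$ and cyclic excess if $\Gamma$ is $d$-regular with $d\ge3$, has odd girth $g\ge5$, and $G_{d,\lfloor g/2\rfloor}(A)=J_n-B$ for some cycle matrix $B$. *)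

(* Defs.v *)
From HB Require Import structures.
From mathcomp Require Import all_boot all_order all_fingroup all_algebra.

Set Implicit Arguments.
Unset Strict Implicit.
Unset Printing Implicit Defensive.

Import GRing.Theory Num.Theory.

Definition simple_graph (T : finType) (e : rel T) : Prop :=
  symmetric e /\ irreflexive e.

Definition regular (T : finType) (e : rel T) (d : nat) : Prop :=
  forall x : T, #|[set y | e x y]| = d.

Definition walk (T : finType) (e : rel T) (x y : T) (k : nat) : Prop :=
  exists p : seq T, [/\ path e x p, last x p = y & size p = k].

Definition has_dist (T : finType) (e : rel T) (x y : T) (k : nat) : Prop :=
  walk e x y k /\ forall l : nat, walk e x y l -> k <= l.

(* The first conjunct forces the graph to be connected. *)
Definition has_diameter (T : finType) (e : rel T) (D : nat) : Prop :=
  (forall x y : T, exists2 k : nat, has_dist e x y k & k <= D) /\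
  (exists x y : T, has_dist e x y D).

(* [ucycle] alone would also accept the empty sequence and, in a simple graph,
   a single edge traversed back and forth. *)
Definition graph_cycle (T : finType) (e : rel T) (c : seq T) : Prop :=
  3 <= size c /\ ucycle e c.

Definition has_girth (T : finType) (e : rel T) (g : nat) : Prop :=
  (exists2 c : seq T, graph_cycle e c & size c = g) /\
  (forall c : seq T, graph_cycle e c -> g <= size c).

Local Open Scope ring_scope.

Fixpoint Gpoly (d m : nat) {struct m} : {poly int} :=
  match m with
  | 0%N => 1
  | m1.+1 =>
    match m1 with
    | 0%N => 'X + 1
    | m2.+1 => 'X * Gpoly d m1 - (d%:Z - 1) *: Gpoly d m2
    end
  end.

Definition adjmx (n : nat) (e : rel 'I_n) : 'M[int]_n :=
  \matrix_(i, j) (e i j)%:R.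

(* The permutation [v] is the ordering of the vertices along the cycle, and
   [ordS] is the successor modulo [n]. *)
Definition cycle_matrix (n : nat) (B : 'M[int]_n) : Prop :=
  (3 <= n)%N /\
  exists v : {perm 'I_n},
    forall i j : 'I_n, B (v i) (v j) = ((j == ordS i) || (i == ordS j))%:R.

(* Graphs of order [n.+1]: [horner_mx] evaluates polynomials at square matrices
   of manifestly positive size. *)
Definition cyclic_defect (n : nat) (e : rel 'I_n.+1) (d D : nat) : Prop :=
  [/\ simple_graph e,
      regular e d /\ (3 <= d)%N,
      has_diameter e D /\ (2 <= D)%N
    & exists2 B : 'M[int]_n.+1, cycle_matrix B
        & horner_mx (adjmx e) (Gpoly d D) = const_mx 1 + B].

Definition cyclic_excess (n : nat) (e : rel 'I_n.+1) (d g : nat) : Prop :=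
  [/\ simple_graph e,
      regular e d /\ (3 <= d)%N,
      [/\ has_girth e g, odd g & (5 <= g)%N]
    & exists2 B : 'M[int]_n.+1, cycle_matrix B
        & horner_mx (adjmx e) (Gpoly d g./2) = const_mx 1 - B].

(* Main.v *)
Require Import Defs.
From HB Require Import structures.
From mathcomp Require Import all_boot all_order all_fingroup all_algebra.
From mathcomp Require Import ring zify.

(**
The all-ones vector is an eigenvector of the adjacency matrix [A], of [J] and
of the cycle matrix [B], which gives [G_k(7) = n + 2] for cyclic defect and
[G_k(7) = n - 2] for cyclic excess; in both cases [n] is even. Hence [B] has
the simple eigenvalue [-2], with the alternating vector [u] as eigenvector.
Since [A] commutes with [J], it commutes with [B], so [u] is an eigenvector of
[A]; its eigenvalue [a] is a sum of seven signs, and [G_k(a) = -2] (defect) or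
[G_k(a) = 2] (excess). The first is impossible modulo 3. Modulo 3, the
second leaves only [a = 1], [a = -5] and [a = 7]; but [G_k(1)] is a multiple of 4, while
[|G_k(-5)|] is at least [3 ^ k] and [G_k(7)] is at least 8.
*)

Set Implicit Arguments.
Unset Strict Implicit.
Unset Printing Implicit Defensive.

Import Order.TTheory GRing.Theory Num.Theory.

Local Open Scope ring_scope.

(** * Evaluation of [Gpoly] at eigenvalues *)

Lemma horner_mx_eigenvector (R : comNzRingType) (n : nat) (A : 'M[R]_n.+1)
    (u : 'cV[R]_n.+1) (a : R) (p : {poly R}) :
  A *m u = a *: u -> horner_mx A p *m u = p.[a] *: u.
Proof.
move=> Au; elim/poly_ind: p => [|p c IHp].
  by rewrite rmorph0 mul0mx horner0 scale0r.
rewrite rmorphD rmorphM /= horner_mx_X horner_mx_C hornerMXaddC mulmxDl.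
rewrite mul_scalar_mx -mulmxE -mulmxA Au -scalemxAr IHp scalerA scalerDl.
by rewrite mulrC.
Qed.

Lemma horner_GpolySS (d m : nat) (x : int) :
  (Gpoly d m.+2).[x]
  = x * (Gpoly d m.+1).[x] - (d%:Z - 1) * (Gpoly d m).[x].
Proof. by rewrite [Gpoly d m.+2]/= hornerD hornerN hornerM hornerX hornerZ. Qed.

Lemma horner_Gpoly0 (d : nat) (x : int) : (Gpoly d 0).[x] = 1.
Proof. by rewrite hornerC. Qed.

Lemma horner_Gpoly1 (d : nat) (x : int) : (Gpoly d 1).[x] = x + 1.
Proof. by rewrite hornerD hornerX hornerC. Qed.

(** * Arithmetic of the values in degree 7 *)

Section DegreeSeven.

Local Notation g7 k x := (Gpoly 7 k).[x].

Let g7SS k x : g7 k.+2 x = x * g7 k.+1 x - 6 * g7 k x.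
Proof. by rewrite horner_GpolySS. Qed.

(** Modulo 3 the recurrence is [G_(k+2) = x G_(k+1)], so [G_(k+2)] is [x ^ (k+1) (x + 1)]. *)
Lemma dvdz3_Gpoly7 (x : int) (k : nat) :
  (3 %| x * (x + 1))%Z -> (3 %| g7 k.+2 x)%Z.
Proof.
move=> x3; have g6 j : (3 %| 6 * g7 j x)%Z by rewrite dvdz_mulr.
elim: k => [|k IHk]; rewrite g7SS rpredB // ?horner_Gpoly1 //.
by rewrite dvdz_mull.
Qed.

Lemma Gpoly7_mod3 (x : int) (k : nat) :
  (3 %| x - 1)%Z -> (3 %| g7 k.+1 x - 2)%Z.
Proof.
move=> x3; elim: k => [|k IHk].
  by rewrite horner_Gpoly1 (_ : x + 1 - 2 = x - 1) //; ring.
rewrite g7SS (_ : _ - 2 = (x - 1) * g7 k.+1 x + (g7 k.+1 x - 2)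
                          - 6 * g7 k x); last by ring.
by apply: rpredB; [apply: rpredD => //|]; rewrite dvdz_mulr.
Qed.

Lemma dvdz4_Gpoly7_1 (k : nat) : (4 %| g7 k.+2 1)%Z.
Proof.
suff [] : (4 %| g7 k.+2 1)%Z /\ (4 %| g7 k.+3 1)%Z by [].
elim: k => [|k [IHk IHk1]].
  by rewrite !g7SS horner_Gpoly1 horner_Gpoly0.
by split=> //; rewrite g7SS mul1r rpredB // dvdz_mull.
Qed.

(** With [h_k = (-1)^k G_k(-5)], the recurrence gives [h_(k+2) - 3 h_(k+1) = 2 (h_(k+1) - 3 h_k)],
    so [h_(k+1) >= 3 h_k] persists from [h_0 = 1], [h_1 = 4]. *)
Lemma Gpoly7_N5_ge (k : nat) : 3 ^+ k <= (-1) ^+ k * g7 k (-5).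
Proof.
suff [] : 3 ^+ k <= (-1) ^+ k * g7 k (-5) /\
    3 * ((-1) ^+ k * g7 k (-5)) <= (-1) ^+ k.+1 * g7 k.+1 (-5) by [].
elim: k => [|k [IHk IHk1]].
  by rewrite horner_Gpoly1 horner_Gpoly0.
split; first by rewrite exprS; lia.
rewrite g7SS; move: IHk1; rewrite !exprS; lia.
Qed.

(** Increments are multiplied by 6 at each step, so the values never decrease from [G_1(7) = 8]. *)
Lemma Gpoly7_7_ge (k : nat) : 8 <= g7 k.+1 7.
Proof.
suff [] : 8 <= g7 k.+1 7 /\ g7 k.+1 7 <= g7 k.+2 7 by [].
elim: k => [|k [IHk IHk1]].
  by rewrite !g7SS horner_Gpoly1 horner_Gpoly0.
by split; last rewrite [leRHS]g7SS; lia.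
Qed.

Lemma dvdz2_Gpoly7_7 (k : nat) : (2 %| g7 k.+1 7)%Z.
Proof.
elim: k => [|k IHk]; first by rewrite horner_Gpoly1.
by rewrite g7SS rpredB ?[(2 %| 7 * _)%Z]dvdz_mull // dvdz_mulr.
Qed.

(** Modulo 3 the value is 0 or 2, whereas -2 is 1. *)
Lemma Gpoly7_neqN2 (x : int) (k : nat) : g7 k.+2 x <> - 2.
Proof.
move=> gx; have [x3|x3] : (3 %| x * (x + 1))%Z \/ (3 %| x - 1)%Z.
- have : x = (x %/ 3)%Z * 3 + (x %% 3)%Z by exact: divz_eq.
  have : (x %% 3)%Z = 0 \/ (x %% 3)%Z = 1 \/ (x %% 3)%Z = 2 by lia.
  by move=> [->|[->|->]] ->; [left; rewrite dvdz_mulr|right|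
    left; rewrite dvdz_mull]; lia.
- by have := dvdz3_Gpoly7 k x3; rewrite gx.
- by have := Gpoly7_mod3 k.+1 x3; rewrite gx.
Qed.

Lemma Gpoly7_neq2 (c k : nat) : (c <= 7)%N -> g7 k.+2 (7 - 2 * c%:Z) <> 2.
Proof.
have no3 (x : int) : (3 %| x * (x + 1))%Z -> g7 k.+2 x <> 2.
  by move=> x3 gx; have := dvdz3_Gpoly7 k x3; rewrite gx.
(* Only [c = 0, 3, 6], that is [x = 7, 1, -5], are 1 modulo 3 and survive [no3]. *)
case: c => [|[|[|[|[|[|[|[|//]]]]]]]] _; try exact: no3.
- by have := Gpoly7_7_ge k.+1; rewrite mulr0 subr0 => + E; rewrite E.
- by have := dvdz4_Gpoly7_1 k => + E; rewrite -[1]/(7 - 2 * 3%:Z) E.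
- have := Gpoly7_N5_ge k.+2 => + E; rewrite -[-5]/(7 - 2 * 6%:Z) E.
  have : 1 <= 3 ^+ k :> int by rewrite exprn_ege1.
  rewrite !exprS !mulN1r opprK -signr_odd; move: (3 ^+ k) => t t1.
  by case: (odd k); rewrite ?expr0 ?expr1; lia.
Qed.

End DegreeSeven.

(** * Successors, harmonic functions and parity on a cycle *)

Lemma ord_pred_neqS (n : nat) (i : 'I_n) : (2 < n)%N -> ord_pred i != ordS i.
Proof.
move=> n_gt2; apply/eqP => /(congr1 (@ordS n)); rewrite ord_predK.
move/(congr1 val) => /=; have := ltn_ord i => i_lt.
rewrite -[_.+1]addn1 modnDml addn1 -{1}(modn_small i_lt).
move/eqP; rewrite -[i.+1.+1]addn2 -{1}[nat_of_ord i]addn0 eqn_modDl.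
by rewrite mod0n modn_small.
Qed.

Lemma sum_ordS (V : nmodType) (n : nat) (f : 'I_n -> V) :
  \sum_i f (ordS i) = \sum_i f i.
Proof. by rewrite [RHS](reindex_inj (@ordS_inj n)). Qed.

(* Summing [y_i (2 y_i - y_(i+1) - y_(i-1))] over the cycle yields the energy
   [\sum_i (y_(i+1) - y_i)^2]. *)
Lemma cyclic_harmonic_const (R : realDomainType) (n : nat) (y : 'I_n.+1 -> R) :
  (forall i, y (ordS i) + y (ord_pred i) = y i *+ 2) ->
  forall i, y i = y ord0.
Proof.
move=> harm.
have energy : \sum_i (y (ordS i) - y i) ^+ 2 = 0.
  rewrite (eq_bigr (fun i => (y (ordS i) ^+ 2 - y (ordS i) * y i)
                             + (y i ^+ 2 - y (ordS i) * y i))); last first.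
    by move=> i _; ring.
  rewrite big_split /=.
  rewrite (eq_bigr (fun i => (fun j => y j ^+ 2 - y j * y (ord_pred j)) (ordS i)));
    last by move=> i _; rewrite ordSK.
  rewrite (sum_ordS (fun j => y j ^+ 2 - y j * y (ord_pred j))) -big_split /=.
  rewrite big1 // => i _; rewrite -[RHS](mulr0 (y i)).
  by rewrite -(subrr (y i *+ 2)) -{2}harm; ring.
have step i : y (ordS i) = y i.
  apply/eqP; rewrite -subr_eq0 -sqrf_eq0; apply/eqP.
  by move: i (isT); apply: (psumr_eq0P _ energy) => i _; rewrite sqr_ge0.
case=> m; elim: m => [|m IHm] lt_m; first by congr y; apply: val_inj.
rewrite -(IHm (ltnW lt_m)) -[RHS]step; congr y; apply: val_inj => /=.
by rewrite modn_small.
Qed.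

Lemma odd_ordS (n : nat) (i : 'I_n) : ~~ odd n -> odd (ordS i) = ~~ odd i.
Proof.
move=> n_even /=; rewrite -[in RHS](negbK (odd i)) -oddS negbK.
by rewrite {2}(divn_eq i.+1 n) oddD oddM (negbTE n_even) andbF.
Qed.

(** * The eigenvalue -2 of a cycle matrix *)

Section CycleMatrix.

Variables (n : nat) (B : 'M[int]_n.+1) (v : {perm 'I_n.+1}).
Hypothesis n_gt2 : (2 < n.+1)%N.
Hypothesis Bv :
  forall i j, B (v i) (v j) = ((j == ordS i) || (i == ordS j))%:R.

Lemma cycle_mulmx (w : 'cV[int]_n.+1) i :
  (B *m w) (v i) 0 = w (v (ordS i)) 0 + w (v (ord_pred i)) 0.
Proof.
rewrite mxE (reindex_inj (@perm_inj _ v)) /= (bigD1 (ordS i)) //=.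
rewrite (bigD1 (ord_pred i)) ?ord_pred_neqS //= big1 => [|j /andP[j1 j2]].
  by rewrite addr0 !Bv eqxx ord_predK eqxx orbT !mul1r.
rewrite Bv (negbTE j1) /=; case: eqP => [ij|]; last by rewrite mul0r.
by rewrite ij ordSK eqxx in j2.
Qed.

(** The inverse of [v] sends a vertex to its position on the cycle. *)
Definition alternating_vector : 'cV[int]_n.+1 :=
  \col_i (-1) ^+ odd ((v^-1)%g i).

Local Notation u := alternating_vector.

Hypothesis n_even : ~~ odd n.+1.

Lemma alternating_vectorS i : u (v (ordS i)) 0 = - u (v i) 0.
Proof. by rewrite !mxE !permK odd_ordS //; case: odd. Qed.

Lemma alternating_vector_pred i : u (v (ord_pred i)) 0 = - u (v i) 0.
Proof. by rewrite -[in RHS](ord_predK i) alternating_vectorS opprK. Qed.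

Lemma col_permP (w z : 'cV[int]_n.+1) :
  (forall i, w (v i) 0 = z (v i) 0) -> w = z.
Proof. by move=> wz; apply/colP => i; rewrite -(permKV v i). Qed.

Lemma cycle_mul_alternating : B *m u = (-2) *: u.
Proof.
apply: col_permP => i; rewrite cycle_mulmx alternating_vectorS.
by rewrite alternating_vector_pred [RHS]mxE; ring.
Qed.

Lemma const_mul_alternating : const_mx 1 *m u = 0 :> 'cV[int]_n.+1.
Proof.
apply/colP => i; rewrite !mxE.
under eq_bigr => j _ do rewrite mxE mul1r.
rewrite (reindex_inj (@perm_inj _ v)) /=.
(* Shifting by one step along the cycle negates every term. *)
set S := \sum_j _; have : S = - S.
  rewrite -[LHS](sum_ordS (fun j => u (v j) 0)) /S -sumrN.
  by apply: eq_bigr => j _; rewrite alternating_vectorS.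
by lia.
Qed.

(** Multiplying [w] entrywise by the signs of [u] makes it harmonic along the cycle, hence
    constant. *)
Lemma cycle_eigenspaceN2 (w : 'cV[int]_n.+1) :
  B *m w = (-2) *: w -> w = w (v ord0) 0 *: u.
Proof.
move=> Bw; have u2 i : u (v i) 0 * u (v i) 0 = 1.
  by rewrite mxE; case: odd.
have harm i : u (v (ordS i)) 0 * w (v (ordS i)) 0
    + u (v (ord_pred i)) 0 * w (v (ord_pred i)) 0 = (u (v i) 0 * w (v i) 0) *+ 2.
  rewrite alternating_vectorS alternating_vector_pred.
  have := congr1 (fun z : 'cV[int]__ => z (v i) 0) Bw.
  by rewrite cycle_mulmx [RHS]mxE => E; rewrite !mulNr -opprD -mulrDr E; ring.
have const := cyclic_harmonic_const harm.
apply: col_permP => i; rewrite [RHS]mxE -[LHS]mul1r -(u2 i) -mulrA const.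
by rewrite [u (v ord0) 0]mxE permK mul1r mulrC.
Qed.

End CycleMatrix.

(** * Adjacency matrices of regular graphs *)

Lemma adjmx_mul_ones (n : nat) (e : rel 'I_n) (d : nat) :
  regular e d -> adjmx e *m const_mx 1 = d%:Z *: const_mx 1 :> 'cV[int]_n.
Proof.
move=> reg; apply/colP => i; rewrite !mxE -(reg i) -sum1_card -natz.
rewrite natr_sum mulr1 [RHS]big_mkcond /=; apply: eq_bigr => j _.
by rewrite !mxE mulr1 inE; case: (e i j).
Qed.

Lemma ones_mul_adjmx (n : nat) (e : rel 'I_n) (d : nat) :
  symmetric e -> regular e d ->
  const_mx 1 *m adjmx e = d%:Z *: const_mx 1 :> 'M[int]_n.
Proof.
move=> symm reg; apply/matrixP => i j; rewrite !mxE -(reg j) -sum1_card -natz.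
rewrite natr_sum mulr1 [RHS]big_mkcond /=; apply: eq_bigr => k _.
by rewrite !mxE mul1r inE symm; case: (e j k).
Qed.

(* With [u_j = 1 - 2 b_j], the entry is [d - 2 c] where [c] counts the
   neighbours [j] with [b_j = 1]. *)
Lemma adjmx_mul_sign (n : nat) (e : rel 'I_n) (d : nat) (b : 'I_n -> bool) i :
  regular e d -> exists2 c : nat, (c <= d)%N &
    (adjmx e *m \col_j (-1) ^+ b j) i 0 = d%:Z - 2 * c%:Z.
Proof.
move=> reg; exists (\sum_(j in [set j | e i j]) b j)%N.
  by rewrite -(reg i) -sum1_card; apply: leq_sum => j _; case: (b j).
rewrite mxE -(reg i) -sum1_card -!natz !natr_sum mulr_sumr -sumrB.
rewrite [RHS]big_mkcond /=; apply: eq_bigr => j _.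
by rewrite !mxE inE; case: (e i j); case: (b j).
Qed.

(** The sign [s] covers both cases: 1 for defect, -1 for excess. *)
Lemma regular7_cyclic_eigenvalue (n k : nat) (e : rel 'I_n.+1)
    (B : 'M[int]_n.+1) (s : int) :
  symmetric e -> regular e 7 -> cycle_matrix B -> s * s = 1 ->
  horner_mx (adjmx e) (Gpoly 7 k.+1) = const_mx 1 + s *: B ->
  exists2 c : nat, (c <= 7)%N & (Gpoly 7 k.+1).[7 - 2 * c%:Z] = - (2 * s).
Proof.
move=> symm reg [n_gt2 [v Bv]] s2 GA; set A := adjmx e in GA.
have order : (Gpoly 7 k.+1).[7] = n.+1%:Z + 2 * s.
  have := horner_mx_eigenvector (Gpoly 7 k.+1) (adjmx_mul_ones reg).
  rewrite GA mulmxDl -scalemxAl => /(congr1 (fun z : 'cV[int]__ => z (v ord0) 0)).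
  rewrite mxE [in LHS]mxE [X in _ + X]mxE (cycle_mulmx n_gt2 Bv) !mxE.
  under eq_bigr => j _ do rewrite !mxE mulr1.
  by rewrite sumr_const card_ord -natz mulr1 => <-; ring.
have n_even : ~~ odd n.+1.
  by have := dvdz2_Gpoly7_7 k; rewrite order; lia.
pose u := alternating_vector v.
have Bu : B *m u = (-2) *: u by exact: cycle_mul_alternating.
have Ju : const_mx 1 *m u = 0 :> 'cV[int]_n.+1 by exact: const_mul_alternating.
have Au : A *m u = (A *m u) (v ord0) 0 *: u.
  apply: (cycle_eigenspaceN2 n_gt2 Bv n_even).
  (* [A] commutes with its own polynomial; the all-ones matrix kills both [u] and [A *m u], which
     leaves [B *m (A *m u) = -2 *: (A *m u)] up to the factor [s]. *)
  have : (const_mx 1 + s *: B) *m (A *m u) = A *m ((const_mx 1 + s *: B) *m u).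
    rewrite -GA !mulmxA; congr (_ *m u).
    exact/comm_horner_mx/comm_mx_refl.
  rewrite !mulmxDl Ju add0r mulmxA (ones_mul_adjmx symm reg) -scalemxAl Ju.
  rewrite scaler0 add0r -!scalemxAl Bu -!scalemxAr.
  move/(congr1 (fun z => s *: z)); rewrite !scalerA s2 !scale1r => ->.
  by rewrite mulrA s2 mul1r.
(* At the vertex [v ord0] the entry of [u] is 1, so the eigenvalue is the entry of [A *m u]
   there. *)
have [c c_le7 Ec] := adjmx_mul_sign (fun i => odd ((v^-1)%g i)) (v ord0) reg.
exists c => //; rewrite -Ec.
have := horner_mx_eigenvector (Gpoly 7 k.+1) Au.
rewrite GA mulmxDl Ju add0r -scalemxAl Bu scalerA.
move/(congr1 (fun z : 'cV[int]__ => z (v ord0) 0)).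
by rewrite [LHS]mxE [RHS]mxE [u _ _]mxE permK !mulr1 => <-; ring.
Qed.

Local Close Scope ring_scope.

Theorem theorem7 :
  (forall D : nat, 3 <= D ->
     ~ exists (n : nat) (e : rel 'I_n.+1), cyclic_defect e 7 D) /\
  (forall g : nat, odd g -> 7 <= g ->
     ~ exists (n : nat) (e : rel 'I_n.+1), cyclic_excess e 7 g).
Proof.
split.
- case=> [|[|k]] // _ [n [e [[symm _] [reg _] _ [B cycB GA]]]].
  have [c _] : exists2 c : nat, c <= 7 &
      ((Gpoly 7 k.+2).[7 - 2 * c%:Z] = - (2 * 1))%R.
    by apply: (regular7_cyclic_eigenvalue symm reg cycB); rewrite ?scale1r.
  exact: Gpoly7_neqN2.
- move=> g _ g_ge7 [n [e [[symm _] [reg _] _ [B cycB GA]]]].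
  have [k Ek] : exists k, g./2 = k.+2 by exists (g./2 - 2); lia.
  rewrite Ek in GA.
  have [c c_le7] : exists2 c : nat, c <= 7 &
      ((Gpoly 7 k.+2).[7 - 2 * c%:Z] = - (2 * -1))%R.
    by apply: (regular7_cyclic_eigenvalue symm reg cycB); rewrite ?scaleN1r.
  exact: Gpoly7_neq2.
Qed.
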